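(* Let $n = p_1^{\alpha_1} p_2^{\alpha_2}\cdots p_s^{\alpha_s}$ be the prime power factorization of $n$, where $s \geq 1$, $p_1 < p_2 < \cdots < p_s$ are distinct primes and $\alpha_i \geq 1$ for all $1 \leq i \leq s$. Let $G(\mathbb{Z}_n)$ be the zero-divisor graph of $\mathbb{Z}_n$, with vertex set $\mathbb{Z}_n \setminus \{0\}$. Then: (1) If $n$ is square-free, the clique number of $G(\mathbb{Z}_n)$ is $s$. (2) If $\alpha_i$ is even for all $1 \leq i \leq s$, the clique number of $G(\mathbb{Z}_n)$ is $p_1^{\alpha_1/2} p_2^{\alpha_2/2} \cdots p_s^{\alpha_s/2} - 1$. (3) Otherwise, write $n = \ell_1^{\delta_1}\cdots \ell_r^{\delta_r}\, q_1^{\beta_1}\cdots q_t^{\beta_t}$, where $\ell_1,\dots,\ell_r$ (with $r \geq 0$) are the distinct primes dividing $n$ to an even exponent, $\delta_i$ being the (positive, even) exponent of $\ell_i$ for $i = 1,\dots,r$, and $q_1,\dots,q_t$ (with $t \geq 1$) are the distinct primes dividing $n$ to an odd exponent, $\beta_j$ being the (odd) exponent of $q_j$ for $j=1,\dots,t$. Then the clique number of $G(\mathbb{Z}_n)$ is $$\ell_1^{\delta_1/2}\cdots \ell_r^{\delta_r/2}\, q_1^{(\beta_1-1)/2}\cdots q_t^{(\beta_t-1)/2} + t - 1.$$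
   Context: The zero-divisor graph $G(\mathbb{Z}_n)$ of the ring $\mathbb{Z}_n$ of integers modulo $n$ is the simple graph whose vertex set is $\mathbb{Z}_n \setminus \{0\}$ (all nonzero elements, not only the zero-divisors), in which two vertices $x$ and $y$ are adjacent if and only if $x \neq y$ and $x\cdot y \equiv 0 \pmod n$. A clique in a graph is a complete subgraph (any two distinct vertices in it are adjacent), and the clique number of a graph is the order (number of vertices) of its largest clique. An empty product equals $1$. *)

(* Defs.v *)
From mathcomp Require Import all_boot all_order all_algebra.

Set Implicit Arguments.
Unset Strict Implicit.
Unset Printing Implicit Defensive.

Record sgraph := SGraph {
  vertex :> finType;
  adj : rel vertex;
  adj_sym : symmetric adj;
  adj_irrefl : irreflexive adj
}.

Definition clique (G : sgraph) (S : {set G}) : bool :=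
  [forall x in S, forall y in S, (x != y) ==> adj x y].

Definition clique_number (G : sgraph) : nat :=
  \max_(S : {set G} | clique S) #|S|.

Definition square_free (n : nat) : Prop :=
  forall p : nat, prime p -> ~~ (p ^ 2 %| n).

(* 'Z_n is the ring of integers modulo n only when n > 1 ('Z_0 and 'Z_1 are
   copies of 'Z_2), so the graph below is meaningful for n > 1. *)
Definition zdg_vertex (n : nat) : finType := {x : 'Z_n | (x != 0)%R}.

Definition zdg_adj (n : nat) : rel (zdg_vertex n) :=
  fun x y => (x != y) && ((val x * val y)%R == 0%R).

Lemma zdg_adj_sym (n : nat) : symmetric (@zdg_adj n).
Proof. by move=> x y; rewrite /zdg_adj eq_sym GRing.mulrC. Qed.

Lemma zdg_adj_irrefl (n : nat) : irreflexive (@zdg_adj n).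
Proof. by move=> x; rewrite /zdg_adj eqxx. Qed.

Definition zero_divisor_graph (n : nat) : sgraph :=
  SGraph (@zdg_adj_sym n) (@zdg_adj_irrefl n).

(* Main.v *)
Require Import Defs.
From mathcomp Require Import all_boot all_order all_algebra.

(** Write [v p] for the exponent of [p] in [n], and put
      [D] = the product of [p ^ ceil (v p / 2)] over the primes [p] of [n],
      [m] = the product of [p ^ floor (v p / 2)], so that [n = D * m].
    All three cases are instances of one formula: the clique number is
    [m - 1 + t], where [t] is the number of primes with odd exponent
    ([clique_number_zdg]).  For a prime [p] of [n] let
    [w p = n / p ^ ceil (v p / 2)]; then [n %| w p * z] exactly when
    [p ^ ceil (v p / 2) %| z].

    Lower bound: the [m - 1] nonzero multiples of [D] together with the [t]
    residues [w q], for [v q] odd, form a clique, called [canonical_clique].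

    Upper bound: any clique [S] injects into [canonical_clique].  A multiple of
    [D] is sent to itself.  Any other [x] in [S] has a deficient prime [p], one
    for which [p ^ ceil (v p / 2)] does not divide [x], and is sent to [w p],
    which is a multiple of [D] if [v p] is even.  The key point
    ([adjacent_deficient]) is that if [p] is deficient for [x], then every other
    [y] in [S] has [p]-adic valuation exceeding [floor (v p / 2)], the
    valuation of [w p].  So [y] is not [w p], and [p] is not deficient for
    [y] either. *)

Set Implicit Arguments.
Unset Strict Implicit.
Unset Printing Implicit Defensive.

(** * Valuations of products of prime powers *)

Lemma logn_prod_expn (I : eqType) (r : seq I) (f e : I -> nat) (i : I) :
    uniq r -> injective f -> (forall j, j \in r -> prime (f j)) -> i \in r ->
  logn (f i) (\prod_(j <- r) f j ^ e j) = e i.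
Proof.
move=> Ur injf pr ir; have pri := pr _ ir.
rewrite (big_rem i) //= lognM; first last.
- rewrite big_seq; apply: prodn_cond_gt0 => j /mem_rem jr.
  by rewrite expn_gt0 prime_gt0 ?pr.
- by rewrite expn_gt0 prime_gt0.
rewrite pfactorK // logn_coprime ?addn0 // big_seq.
apply: (big_ind (fun k => coprime (f i) k)) => [|a b|j].
- exact: coprimen1.
- by move=> ha hb; rewrite coprimeMr ha hb.
rewrite rem_filter // mem_filter /= => /andP[ji jr].
rewrite coprimeXr // prime_coprime // dvdn_prime2 ?pr //.
by apply: contraNN ji => /eqP /injf ->.
Qed.

Lemma prime_dvd_prod_expn (I : eqType) (r : seq I) (f e : I -> nat) (x : nat) :
    prime x -> (forall j, j \in r -> prime (f j)) ->
    x %| \prod_(j <- r) f j ^ e j ->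
  exists2 j, j \in r & x = f j.
Proof.
move=> xp; elim: r => [|j r IH] pr.
  by rewrite big_nil dvdn1 => /eqP x1; rewrite x1 in xp.
rewrite big_cons Euclid_dvdM // => /orP[|/IH[i ir|i ir ->]].
- rewrite Euclid_dvdX // => /andP[]; rewrite dvdn_prime2 ?pr ?mem_head //.
  by move=> /eqP -> _; exists j; rewrite ?mem_head.
- by apply: pr; rewrite inE ir orbT.
- by exists i; rewrite // inE ir orbT.
Qed.

Lemma prod_expn_logn (n : nat) : 0 < n -> n = \prod_(p <- primes n) p ^ logn p n.
Proof.
move=> n0; rewrite {1}[n]prod_prime_decomp // prime_decompE big_map.
by apply: eq_bigr => p _.
Qed.

(** * The canonical clique, as a list of natural numbers *)

(** [low_root n] and [high_root n] are [m] and [D]: the exponents of [n] are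
    halved, and rounded down, respectively up. *)
Definition low_root (n : nat) := \prod_(p <- primes n) p ^ (logn p n)./2.
Definition high_root (n : nat) := \prod_(p <- primes n) p ^ uphalf (logn p n).

(** The least power of [p] whose square is divisible by the full power of [p]
    in [n]. *)
Definition high_part (n p : nat) := p ^ uphalf (logn p n).

(** The residue [w p], whose valuation is [floor (v p / 2)] at [p] and equals
    that of [n] at the other primes. *)
Definition cofactor_at (n p : nat) := n %/ high_part n p.

Definition odd_primes (n : nat) := [seq p <- primes n | odd (logn p n)].

Definition canonical_clique (n : nat) :=
  [seq high_root n * i | i <- iota 1 (low_root n - 1)]
    ++ [seq cofactor_at n q | q <- odd_primes n].

Lemma low_root_gt0 n : 0 < low_root n.
Proof.
rewrite /low_root big_seq; apply: prodn_cond_gt0 => p.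
by rewrite mem_primes => /and3P[pp _ _]; rewrite expn_gt0 prime_gt0.
Qed.

Lemma high_root_gt0 n : 0 < high_root n.
Proof.
rewrite /high_root big_seq; apply: prodn_cond_gt0 => p.
by rewrite mem_primes => /and3P[pp _ _]; rewrite expn_gt0 prime_gt0.
Qed.

Lemma high_low_root n : 0 < n -> high_root n * low_root n = n.
Proof.
move=> n0; rewrite [RHS]prod_expn_logn // /high_root /low_root -big_split /=.
by apply: eq_bigr => p _; rewrite -expnD uphalf_half -addnA addnn odd_double_half.
Qed.

Lemma low_dvd_high_root n : low_root n %| high_root n.
Proof.
rewrite /low_root /high_root; elim: (primes n) => [|p s IH]; first by rewrite !big_nil.
by rewrite !big_cons dvdn_mul // dvdn_exp2l // uphalf_half leq_addl.
Qed.

Section Positive.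

Variable n : nat.
Hypothesis n0 : 0 < n.

Lemma logn_high_root p : p \in primes n -> logn p (high_root n) = uphalf (logn p n).
Proof.
move=> pn; apply: (@logn_prod_expn _ _ id); rewrite ?primes_uniq //.
by move=> q; rewrite mem_primes => /andP[].
Qed.

Lemma logn_low_root p : p \in primes n -> logn p (low_root n) = (logn p n)./2.
Proof.
move=> pn; apply: (@logn_prod_expn _ _ id); rewrite ?primes_uniq //.
by move=> q; rewrite mem_primes => /andP[].
Qed.

Lemma primes_logn_gt0 p : p \in primes n -> prime p /\ 0 < logn p n.
Proof. by move=> pn; rewrite logn_gt0 pn; move: pn; rewrite mem_primes => /andP[]. Qed.

Lemma high_part_gt0 p : p \in primes n -> 0 < high_part n p.
Proof. by case/primes_logn_gt0=> pp _; rewrite expn_gt0 prime_gt0. Qed.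

Lemma high_part_dvd p : p \in primes n -> high_part n p %| n.
Proof.
case/primes_logn_gt0=> pp _; rewrite pfactor_dvdn // leq_uphalf_double.
by rewrite -addnn leq_addr.
Qed.

Lemma high_part_dvd_high_root p : p \in primes n -> high_part n p %| high_root n.
Proof.
move=> pn; have [pp _] := primes_logn_gt0 pn.
by rewrite pfactor_dvdn ?high_root_gt0 // logn_high_root.
Qed.

Lemma high_root_dvdP x :
  0 < x -> (forall p, p \in primes n -> high_part n p %| x) -> high_root n %| x.
Proof.
move=> x0 H; apply/(dvdn_partP _ (high_root_gt0 n)) => p pD.
have pn : p \in primes n.
  move: pD; rewrite !mem_primes high_root_gt0 n0 /= => /andP[-> pD] /=.
  by apply: dvdn_trans pD _; rewrite -{2}(high_low_root n0) dvdn_mulr.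
by rewrite p_part logn_high_root //; apply: H.
Qed.

Lemma cofactor_atK p : p \in primes n -> cofactor_at n p * high_part n p = n.
Proof. by move=> pn; rewrite divnK // high_part_dvd. Qed.

Lemma cofactor_at_gt0 p : p \in primes n -> 0 < cofactor_at n p.
Proof. by move=> pn; rewrite -(ltn_pmul2r (high_part_gt0 pn)) cofactor_atK. Qed.

Lemma cofactor_at_lt p : p \in primes n -> cofactor_at n p < n.
Proof.
move=> pn; have [pp l0] := primes_logn_gt0 pn.
rewrite ltn_Pdiv // -{1}(expn0 p) ltn_exp2l ?prime_gt1 //.
by rewrite uphalf_gt0.
Qed.

Lemma dvd_cofactor_atM p z :
  p \in primes n -> (n %| cofactor_at n p * z) = (high_part n p %| z).
Proof.
by move=> pn; rewrite -{1}(cofactor_atK pn) dvdn_pmul2l // cofactor_at_gt0.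
Qed.

Lemma logn_cofactor_at p : p \in primes n -> logn p (cofactor_at n p) = (logn p n)./2.
Proof.
move=> pn; have [pp l0] := primes_logn_gt0 pn.
rewrite logn_div ?high_part_dvd // pfactorK //.
rewrite -{1}[logn p n]odd_double_half uphalf_half -addnn addnA.
by rewrite addKn.
Qed.

Lemma logn_cofactor_at_neq p q : p \in primes n -> q \in primes n -> p != q ->
  logn q (cofactor_at n p) = logn q n.
Proof.
move=> pn qn pq; have [pp _] := primes_logn_gt0 pn.
have [qp _] := primes_logn_gt0 qn.
rewrite logn_div ?high_part_dvd // lognX (logn_prime q pp) eq_sym (negbTE pq).
by rewrite muln0 subn0.
Qed.

Lemma cofactor_at_inj : {in primes n &, injective (cofactor_at n)}.
Proof.
move=> p q pn qn /(congr1 (logn p)) E; apply/eqP; apply: contraT => pq.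
have [_ l0] := primes_logn_gt0 pn.
rewrite eq_sym in pq; move: E.
rewrite logn_cofactor_at // (logn_cofactor_at_neq qn pn pq) => E.
move: (ltn_half_double (logn p n) (logn p n)); rewrite E ltnn => /esym/negbT.
by rewrite -addnn -{1}[logn p n]addn0 ltn_add2l l0.
Qed.

Lemma high_root_dvd_cofactor_at p :
  p \in primes n -> ~~ odd (logn p n) -> high_root n %| cofactor_at n p.
Proof.
move=> pn ev; rewrite -(dvdn_pmul2r (high_part_gt0 pn)) cofactor_atK //.
rewrite -{3}(high_low_root n0) dvdn_pmul2l ?high_root_gt0 //.
have [pp _] := primes_logn_gt0 pn.
rewrite pfactor_dvdn ?low_root_gt0 // logn_low_root // uphalf_half.
by rewrite (negbTE ev).
Qed.

Lemma high_root_ndvd_cofactor_at p :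
  p \in primes n -> odd (logn p n) -> ~~ (high_root n %| cofactor_at n p).
Proof.
move=> pn od; apply/negP => /(dvdn_trans (high_part_dvd_high_root pn)).
have [pp _] := primes_logn_gt0 pn.
rewrite pfactor_dvdn ?cofactor_at_gt0 // logn_cofactor_at // uphalf_half od.
by rewrite ltnn.
Qed.

(** If [p] is deficient for [x] and [n %| x * y], the valuation of [y] at [p] is
    too large for [y] to equal [cofactor_at n p] or for [p] to be deficient for
    [y]. *)
Lemma adjacent_deficient x y p : p \in primes n -> 0 < x -> 0 < y -> n %| x * y ->
  ~~ (high_part n p %| x) -> (logn p n)./2 < logn p y.
Proof.
move=> pn x0 y0 nxy; have [pp _] := primes_logn_gt0 pn.
rewrite pfactor_dvdn // -ltnNge => lx.
have xy0 : 0 < x * y by rewrite muln_gt0 x0.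
have := dvdn_leq_log p xy0 nxy; rewrite lognM // => le.
rewrite -(ltn_add2l (logn p x)); apply: leq_trans le.
rewrite -{2}[logn p n]odd_double_half -addnn addnA -uphalf_half.
by rewrite ltn_add2r.
Qed.

(** ** Properties of the canonical clique *)

Lemma mem_odd_primes q :
  (q \in odd_primes n) = odd (logn q n) && (q \in primes n).
Proof. by rewrite mem_filter. Qed.

Lemma size_canonical_clique :
  size (canonical_clique n) = low_root n - 1 + size (odd_primes n).
Proof. by rewrite size_cat !size_map size_iota. Qed.

Lemma mem_canonical_clique_dvd z :
  0 < z < n -> high_root n %| z -> z \in canonical_clique n.
Proof.
move=> /andP[z0 zn] /dvdnP[i zE]; rewrite mem_cat; apply/orP; left.
apply/mapP; exists i; rewrite 1?mulnC // mem_iota.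
move: z0 zn; rewrite zE muln_gt0 => /andP[-> _] /=.
rewrite -{2}(high_low_root n0) mulnC ltn_pmul2l ?high_root_gt0 //.
by rewrite subnKC ?low_root_gt0.
Qed.

Lemma canonical_clique_bounds z : z \in canonical_clique n -> 0 < z < n.
Proof.
rewrite mem_cat => /orP[] /mapP[i].
- rewrite mem_iota subnKC ?low_root_gt0 // => /andP[i0 im] ->.
  by rewrite muln_gt0 high_root_gt0 i0 -{2}(high_low_root n0) ltn_pmul2l ?high_root_gt0.
- rewrite mem_odd_primes => /andP[_ ip] ->.
  by rewrite cofactor_at_gt0 // cofactor_at_lt.
Qed.

Lemma cofactor_at_canonical_clique p :
  p \in primes n -> cofactor_at n p \in canonical_clique n.
Proof.
move=> pn; case: (boolP (odd (logn p n))) => od.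
- by rewrite mem_cat map_f ?orbT // mem_odd_primes od.
- apply: mem_canonical_clique_dvd; last exact: high_root_dvd_cofactor_at.
  by rewrite cofactor_at_gt0 // cofactor_at_lt.
Qed.

Lemma uniq_canonical_clique : uniq (canonical_clique n).
Proof.
rewrite cat_uniq; apply/and3P; split.
- rewrite map_inj_uniq ?iota_uniq // => i j /eqP.
  by rewrite eqn_pmul2l ?high_root_gt0 // => /eqP.
- apply/hasPn => z /mapP[q]; rewrite mem_odd_primes => /andP[od qn] ->.
  apply: contra (high_root_ndvd_cofactor_at qn od) => /mapP[i _ ->].
  exact: dvdn_mulr.
- rewrite map_inj_in_uniq ?filter_uniq ?primes_uniq // => p q.
  rewrite !mem_odd_primes => /andP[_ pn] /andP[_ qn]; exact: cofactor_at_inj.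
Qed.

Lemma dvdn_canonical_clique x y :
  x \in canonical_clique n -> y \in canonical_clique n -> x != y -> n %| x * y.
Proof.
have odd_mem q z : q \in odd_primes n ->
    high_part n q %| z -> n %| cofactor_at n q * z.
  by rewrite mem_odd_primes => /andP[_ qn]; rewrite dvd_cofactor_atM.
rewrite !mem_cat => /orP[] /mapP[i iP ->] /orP[] /mapP[j jP ->] ij.
- rewrite mulnACA dvdn_mulr // -{1}(high_low_root n0).
  by rewrite dvdn_mul // low_dvd_high_root.
- rewrite mulnC; apply: odd_mem => //; apply: dvdn_mulr.
  by move: jP; rewrite mem_odd_primes => /andP[_]; apply: high_part_dvd_high_root.
- apply: odd_mem => //; apply: dvdn_mulr.
  by move: iP; rewrite mem_odd_primes => /andP[_]; apply: high_part_dvd_high_root.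
- apply: odd_mem => //; move: iP jP.
  rewrite !mem_odd_primes => /andP[_ iP] /andP[_ jP].
  have [ip _] := primes_logn_gt0 iP.
  have ji : j != i by apply: contraNneq ij => ->.
  rewrite pfactor_dvdn ?cofactor_at_gt0 // logn_cofactor_at_neq //.
  by rewrite leq_uphalf_double -addnn leq_addr.
Qed.

(** * The upper bound *)

(** A prime deficient for [x], when [x] is not a multiple of [high_root n]
    (and [0] otherwise). *)
Definition deficient_prime x :=
  nth 0 (primes n) (find (fun p => ~~ (high_part n p %| x)) (primes n)).

(** The map sending any clique into the canonical one; it is injective on every
    clique because it separates distinct [x] and [y] with [n %| x * y]. *)
Definition clique_map x :=
  if high_root n %| x then x else cofactor_at n (deficient_prime x).

Lemma deficient_primeP x : 0 < x -> ~~ (high_root n %| x) ->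
  deficient_prime x \in primes n /\ ~~ (high_part n (deficient_prime x) %| x).
Proof.
move=> x0 Dx.
have h : has (fun p => ~~ (high_part n p %| x)) (primes n).
  apply: contraNT Dx => /hasPn h; apply: high_root_dvdP => // p pn.
  by move: (h _ pn); rewrite negbK.
split; last exact: (nth_find 0 h).
by apply: mem_nth; rewrite -has_find.
Qed.

Lemma clique_map_mem x : 0 < x < n -> clique_map x \in canonical_clique n.
Proof.
move=> xb; rewrite /clique_map; case: ifPn => Dx; first exact: mem_canonical_clique_dvd.
have /andP[x0 _] := xb; have [pn _] := deficient_primeP x0 Dx.
exact: cofactor_at_canonical_clique.
Qed.

Lemma clique_map_inj x y : 0 < x -> 0 < y -> n %| x * y ->
  clique_map x = clique_map y -> x = y.
Proof.
move=> x0 y0 nxy; have nyx : n %| y * x by rewrite mulnC.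
(* If [p] is deficient for [u], the valuation at [p] separates [v] from [w p]. *)
have sep u v p : p \in primes n -> 0 < u -> 0 < v -> n %| u * v ->
    ~~ (high_part n p %| u) -> v <> cofactor_at n p.
  move=> pn u0 v0 nuv pu vE; have := adjacent_deficient pn u0 v0 nuv pu.
  by rewrite vE logn_cofactor_at // ltnn.
rewrite /clique_map; case: ifPn => Dx; case: ifPn => Dy //.
- have [pn py] := deficient_primeP y0 Dy; by move/(sep _ _ _ pn y0 x0 nyx py).
- have [pn px] := deficient_primeP x0 Dx; by move/esym/(sep _ _ _ pn x0 y0 nxy px).
have [pn px] := deficient_primeP x0 Dx; have [qn qy] := deficient_primeP y0 Dy.
move/(cofactor_at_inj pn qn) => pq; rewrite -pq in qy.
have := adjacent_deficient pn x0 y0 nxy px.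
have [pp _] := primes_logn_gt0 pn.
move: qy; rewrite pfactor_dvdn // -ltnNge uphalf_half => ly lt.
by move: (leq_trans ly (leq_add (leq_b1 _) (leqnn _))); rewrite add1n ltnS leqNgt lt.
Qed.

End Positive.

(** * The clique number of the zero-divisor graph *)

(** The least natural number representing a vertex. *)
Definition residue (n : nat) (x : zdg_vertex n) : nat := val (val x).

Lemma residue_inj n : injective (@residue n).
Proof. by move=> x y /val_inj /val_inj. Qed.

Lemma residue_bounds n (x : zdg_vertex n) : 1 < n -> 0 < residue x < n.
Proof.
move=> n1; rewrite lt0n -[X in _ < X](Zp_cast n1) (ltn_ord (val x)) andbT.
by apply: contra (valP x) => /eqP x0; apply/eqP/val_inj.
Qed.

Lemma residue_surj n k : 1 < n -> 0 < k < n -> exists x : zdg_vertex n, residue x = k.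
Proof.
move=> n1 /andP[k0 kn]; have kn' : k < (Zp_trunc n).+2 by rewrite Zp_cast.
have kz : ((Ordinal kn' : 'Z_n) != 0)%R.
  by apply: contraTneq k0 => /(congr1 val) /= ->.
by exists (exist (fun x : 'Z_n => is_true (x != 0)%R) _ kz).
Qed.

Lemma zdg_adjE n (x y : zdg_vertex n) : 1 < n ->
  zdg_adj x y = (x != y) && (n %| residue x * residue y).
Proof.
move=> n1; rewrite /zdg_adj; congr (_ && _).
by rewrite -val_eqE /= /dvdn; move: (sval x * sval y) => k; rewrite Zp_cast.
Qed.

(** The uniform formula [m - 1 + t], of which the three cases of the theorem are
    specializations. *)
Theorem clique_number_zdg n : 1 < n ->
  clique_number (zero_divisor_graph n) = low_root n - 1 + size (odd_primes n).
Proof.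
move=> n1; have n0 : 0 < n by apply: ltnW.
rewrite -size_canonical_clique; apply/eqP; rewrite eqn_leq; apply/andP; split.
- apply/bigmax_leqP => S /forallP cS.
  have adjS x y : x \in S -> y \in S -> x != y -> n %| residue x * residue y.
    move=> xS yS xy; move: (cS x); rewrite xS /= => /forallP /(_ y).
    by rewrite yS xy /= zdg_adjE // => /andP[].
  rewrite cardE -(size_map (fun x : zdg_vertex n => clique_map n (residue x))).
  apply: uniq_leq_size => [|z /mapP[x _ ->]]; last first.
    by apply: clique_map_mem => //; apply: residue_bounds.
  rewrite map_inj_in_uniq ?enum_uniq // => x y; rewrite !mem_enum => xS yS E.
  apply/eqP; apply: contraT => xy.
  have /andP[x0 _] := residue_bounds x n1; have /andP[y0 _] := residue_bounds y n1.
  have /residue_inj xyE := clique_map_inj n0 x0 y0 (adjS _ _ xS yS xy) E.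
  by rewrite xyE eqxx in xy.
- pose S := [set x : zero_divisor_graph n | residue (x : zdg_vertex n) \in canonical_clique n].
  apply: (@leq_trans #|S|).
  + rewrite cardE -(size_map (@residue n)); apply: uniq_leq_size.
      exact: uniq_canonical_clique.
    move=> z zK; have [x xE] := residue_surj n1 (canonical_clique_bounds n0 zK).
    by apply/mapP; exists x; rewrite // mem_enum inE xE.
  + apply: leq_bigmax_cond; apply/forallP => x; apply/implyP; rewrite inE => xK.
    apply/forallP => y; apply/implyP; rewrite inE => yK; apply/implyP => xy.
    rewrite [adj _ _]zdg_adjE // xy; apply: dvdn_canonical_clique => //.
Qed.

(** * Square-free, even and mixed factorizations *)

Theorem theorem2 (n s : nat) (p alpha : 'I_s -> nat)
  (s_ge1 : 1 <= s)
  (p_prime : forall i : 'I_s, prime (p i))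
  (p_incr : forall i j : 'I_s, i < j -> p i < p j)
  (alpha_ge1 : forall i : 'I_s, 1 <= alpha i)
  (n_fact : n = \prod_(i < s) p i ^ alpha i) :
  [/\ square_free n -> clique_number (zero_divisor_graph n) = s,
      (forall i : 'I_s, ~~ odd (alpha i)) ->
        clique_number (zero_divisor_graph n)
          = \prod_(i < s) p i ^ (alpha i %/ 2) - 1
    & ~ square_free n ->
      ~ (forall i : 'I_s, ~~ odd (alpha i)) ->
      forall (r t : nat) (l delta : 'I_r -> nat) (q beta : 'I_t -> nat),
        1 <= t ->
        injective l ->
        (forall x : nat, (exists i : 'I_r, l i = x) <->
           [/\ prime x, x %| n & ~~ odd (logn x n)]) ->
        (forall i : 'I_r, delta i = logn (l i) n) ->
        injective q ->
        (forall x : nat, (exists j : 'I_t, q j = x) <->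
           [/\ prime x, x %| n & odd (logn x n)]) ->
        (forall j : 'I_t, beta j = logn (q j) n) ->
        n = (\prod_(i < r) l i ^ delta i) * (\prod_(j < t) q j ^ beta j) ->
        clique_number (zero_divisor_graph n)
          = (\prod_(i < r) l i ^ (delta i %/ 2))
            * (\prod_(j < t) q j ^ ((beta j - 1) %/ 2)) + t - 1].
Proof.
have p_inj : injective p.
  move=> i j E; apply/val_inj; case: (ltngtP i j) => // /p_incr; by rewrite E ltnn.
have n0 : 0 < n.
  by rewrite n_fact; apply: prodn_cond_gt0 => i _; rewrite expn_gt0 prime_gt0.
have logp i : logn (p i) n = alpha i.
  rewrite n_fact; apply: (@logn_prod_expn _ _ p alpha) => //.
  - exact: index_enum_uniq.
  - exact: mem_index_enum.
have primesE : perm_eq (primes n) [seq p i | i <- index_enum 'I_s].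
  apply: uniq_perm; rewrite ?primes_uniq ?map_inj_uniq ?index_enum_uniq // => x.
  apply/idP/mapP => [|[i _ ->]].
  - rewrite mem_primes => /and3P[xp _]; rewrite n_fact => xn.
    exact: (prime_dvd_prod_expn xp _ xn).
  - by rewrite -logn_gt0 logp.
have n1 : 1 < n.
  have := p_prime (Ordinal s_ge1); have := alpha_ge1 (Ordinal s_ge1).
  rewrite -logp logn_gt0 mem_primes => /and3P[pp _ /(dvdn_leq n0)] le _.
  exact: leq_trans (prime_gt1 pp) le.
have logn_primes x : x \in primes n -> exists2 i, x = p i & logn x n = alpha i.
  by rewrite (perm_mem primesE) => /mapP[i _ ->]; exists i.
rewrite clique_number_zdg //; split.
- move=> sf.
  have log1 x : x \in primes n -> logn x n = 1.
    move=> xn; have [xp l0] := primes_logn_gt0 xn.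
    move: (sf x xp); rewrite pfactor_dvdn // -ltnNge ltnS => l1.
    by apply/eqP; rewrite eqn_leq l1.
  have -> : low_root n = 1.
    by rewrite /low_root big_seq big1 // => x /log1 ->.
  rewrite /odd_primes (_ : filter _ _ = primes n).
    by rewrite (perm_size primesE) size_map /index_enum -enumT size_enum_ord.
  by apply/all_filterP/allP => x /log1 ->.
- move=> ev; rewrite (_ : odd_primes n = [::]) ?addn0.
    rewrite /low_root (perm_big _ primesE) big_map.
    by congr (_ - 1); apply: eq_bigr => i _; rewrite logp divn2.
  apply/eqP; rewrite -size_eq0 size_filter eqn0Ngt -has_count -all_predC.
  by apply/allP => x /logn_primes[i _] /= ->.
move=> _ _ r t l delta q beta t1 l_inj lP deltaE q_inj qP betaE _.
have oddE : perm_eq (odd_primes n) [seq q j | j <- index_enum 'I_t].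
  apply: uniq_perm; rewrite ?filter_uniq ?primes_uniq ?map_inj_uniq ?index_enum_uniq // => x.
  rewrite mem_odd_primes mem_primes n0 /=.
  apply/and3P/mapP => [[od xp xn]|[j _ ->]].
  + by have [_ /(_ (And3 xp xn od))[j <-]] := qP x; exists j; rewrite ?mem_index_enum.
  + by have [/(_ (ex_intro _ j erefl))[]] := qP (q j).
have evenE : perm_eq [seq x <- primes n | ~~ odd (logn x n)] [seq l i | i <- index_enum 'I_r].
  apply: uniq_perm; rewrite ?filter_uniq ?primes_uniq ?map_inj_uniq ?index_enum_uniq // => x.
  rewrite mem_filter mem_primes n0 /=.
  apply/and3P/mapP => [[od xp xn]|[j _ ->]].
  + by have [_ /(_ (And3 xp xn od))[j <-]] := lP x; exists j; rewrite ?mem_index_enum.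
  + by have [/(_ (ex_intro _ j erefl))[]] := lP (l j).
have -> : size (odd_primes n) = t.
  by rewrite (perm_size oddE) size_map /index_enum -enumT size_enum_ord.
rewrite addnC addnBA ?low_root_gt0 // addnC; congr (_ + _ - _).
rewrite /low_root (bigID (fun x => odd (logn x n))) /= mulnC; congr (_ * _).
- rewrite -big_filter (perm_big _ evenE) big_map.
  by apply: eq_bigr => i _; rewrite deltaE divn2.
- rewrite -big_filter (perm_big _ oddE) big_map; apply: eq_bigr => j _.
  have [/(_ (ex_intro _ j erefl))[_ _ od] _] := qP (q j).
  rewrite betaE divn2 -{1}[logn _ _]odd_double_half od add1n.
  by rewrite -{2}[logn _ _]odd_double_half od add1n subn1 /= doubleK uphalf_double.
Qed.
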